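(* Let $X\subset\mathbb{R}$ be an interval and $(X,T,\mu)$ a probability preserving dynamical system which is exponentially 4-mixing for $BV$ against $L^\infty$, with the constant $C'$ uniformly bounded when $\psi_1,\psi_2,\varphi_1,\varphi_2$ are indicator functions of intervals. Let $(r_n)_n$ be a decreasing sequence of positive numbers such that $r_n\ge n^{-\beta}$ for some $\beta>0$ and, for some $\varepsilon>0$, \[ \int\mu(B(y,r_n))\,d\mu(y)\ge\frac{(\log n)^4(\log\log n)^{2+\varepsilon}}{n^2} \] for all large $n$. Then $\mu(\liminf_n F_{n,4r_n}^T)=1$.
   Context: $(X,T,\mu)$ is exponentially 4-mixing for $BV$ against $L^\infty$ if there is $\theta'>0$ such that for all $\psi_1,\psi_2$ of bounded variation, all $\varphi_1,\varphi_2\in L^\infty(\mu)$, and all integers $0\le a<b\le c$, $\bigl|\int\psi_1\cdot\psi_2\circ T^a\cdot\varphi_1\circ T^b\cdot\varphi_2\circ T^c\,d\mu-\int\psi_1\cdot\psi_2\circ T^a\,d\mu\int\varphi_1\cdot\varphi_2\circ T^{c-b}\,d\mu\bigr|\le C'(\psi_1,\psi_2,\varphi_1,\varphi_2)e^{-\theta'(b-a)}$ for some constant $C'(\psi_1,\psi_2,\varphi_1,\varphi_2)<\infty$. For $n\in\mathbb{N}$, $r>0$: $F_{n,r}^T:=\{x\in X: |T^ix-T^jx|<r \text{ for some } 0\le i<j<n\}$; $F_{n,4r_n}^T$ is this set with $r=4r_n$. $B(y,r)$ is the open ball of radius $r$ about $y$. *)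

(* Defs.v *)
From HB Require Import structures.
From mathcomp Require Import all_boot all_order all_algebra.
From mathcomp Require Import all_classical all_reals all_analysis.
Set Implicit Arguments. Unset Strict Implicit. Unset Printing Implicit Defensive.
Import Order.TTheory GRing.Theory Num.Theory.
Import numFieldNormedType.Exports.
Local Open Scope classical_set_scope.
Local Open Scope ring_scope.

Section Defs.
Variable R : realType.

Definition BV_on (X : set R) (f : R -> R) : Prop :=
  exists M : R, forall s : seq R, sorted <=%R s -> (forall x, x \in s -> X x) ->
    \sum_(i < (size s).-1) `|f (nth 0 s i.+1) - f (nth 0 s i)| <= M.

Definition Linfty_on (mu : {measure set R -> \bar R}) (X : set R) (f : R -> R) : Prop :=
  measurable_fun X f /\ exists M : R, {ae mu, forall x, `|f x| <= M}.

Definition mix4_bound (mu : {measure set R -> \bar R}) (X : set R) (T : R -> R)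
  (theta C : R) (psi1 psi2 phi1 phi2 : R -> R) : Prop :=
  forall a b c : nat, (a < b)%N -> (b <= c)%N ->
    `| \int[mu]_(x in X) (psi1 x * psi2 (iter a T x) * phi1 (iter b T x)
                            * phi2 (iter c T x))
       - (\int[mu]_(x in X) (psi1 x * psi2 (iter a T x)))
         * (\int[mu]_(x in X) (phi1 x * phi2 (iter (c - b) T x))) |
    <= C * expR (- (theta * (b - a)%:R)).

Definition Fset (X : set R) (T : R -> R) (n : nat) (r : R) : set R :=
  [set x | X x /\ exists i j : nat, (i < j < n)%N /\ `|iter i T x - iter j T x| < r].

Definition liminf_set (F : nat -> set R) : set R :=
  \bigcup_(N in [set: nat]) \bigcap_(n in [set n | (N <= n)%N]) F n.

End Defs.

(* Main.v *)
(** Fix [k] and cut the line into intervals of length [rho = r (2 ^ (k + 3))]. If two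
    iterates [T^i x], [T^j x] with [i < j < 2 ^ (k + 2)] share an interval, then [x] lies
    in [Fset n (4 * r n)] for every [n] between [2 ^ (k + 2)] and [2 ^ (k + 3)]. Let [Z]
    count such coincidences with [i] in the block [0, N), [j] in the block
    [N + g, 2 N + g), where [N = 2 ^ k] and the gap [g] is a large multiple of [k].
    Keeping only the intervals of mass at least [8 ^- k] leaves at most [8 ^ k] of them,
    whether or not [X] is bounded, and the sum [t ^ 2] of their squared masses is still
    at least a third of the integral of [mu (B (y, rho))], up to [O(8 ^- k)]. The mixing
    hypothesis decouples the first block from the second, so that [E(Z)] is close to
    [(N t)^2] and
      [mu (Z = 0) <= 4 (g / N t) + 4 (g / N t)^2 + negligible];
    the term [g / N t] comes from the quadruples with one pair of indices at distance
    less than [g]. By the hypothesis on the integral it is [O(1 / (k (ln k)^(1 + eps/2)))],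
    which is summable, and the Borel-Cantelli lemma concludes. *)
Require Import Defs.
From HB Require Import structures.
From mathcomp Require Import all_boot all_order all_algebra.
From mathcomp Require Import all_classical all_reals all_analysis.
From mathcomp Require Import measurable_realfun zify lra ring.
Import Order.TTheory GRing.Theory Num.Theory.
Import numFieldNormedType.Exports.
Local Open Scope classical_set_scope.
Local Open Scope ring_scope.

(** * Expectations over [X] and the second moment method *)

Section SecondMoment.
Context {d : measure_display} {U : measurableType d} {R : realType}.
Variables (mu : probability U R) (X : set U).
Hypothesis mX : measurable X.

(** A class closed under sums and products whose members are all integrable, so that expectations
    are linear and monotone on it. *)
Definition bdd_meas (h : U -> R) : Prop :=
  measurable_fun X h /\ exists M : R, forall x, X x -> `|h x| <= M.

Local Notation E h := (\int[mu]_(x in X) (h x)).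

Lemma bdd_meas_integrable h : bdd_meas h -> mu.-integrable X (EFin \o h).
Proof.
move=> [mh [M hM]]; apply: measurable_bounded_integrable => //.
  by rewrite ltey_eq fin_num_measure.
exists M; split; first exact: num_real.
by move=> N MN x Xx; exact: le_trans (hM x Xx) (ltW MN).
Qed.

Lemma bdd_meas_cst (c : R) : bdd_meas (fun=> c).
Proof. by split; [exact: measurable_cst | exists `|c|]. Qed.

Lemma bdd_measD f g : bdd_meas f -> bdd_meas g -> bdd_meas (fun x => f x + g x).
Proof.
move=> [mf [M fM]] [mg [N gN]]; split; first exact: measurable_funD.
exists (M + N) => x Xx; apply: (le_trans (ler_normD _ _)).
by rewrite lerD ?fM ?gN.
Qed.

Lemma bdd_measM f g : bdd_meas f -> bdd_meas g -> bdd_meas (fun x => f x * g x).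
Proof.
move=> [mf [M fM]] [mg [N gN]]; split; first exact: measurable_funM.
exists (M * N) => x Xx; rewrite normrM.
by apply: ler_pM => //; [exact: fM|exact: gN].
Qed.

Lemma bdd_meas_sum (I : Type) (s : seq I) (Q : pred I) (f : I -> U -> R) :
  (forall i, bdd_meas (f i)) -> bdd_meas (fun x => \sum_(i <- s | Q i) f i x).
Proof.
move=> bf; elim: s => [|i s IH].
  by under eq_fun do rewrite big_nil; exact: bdd_meas_cst.
under eq_fun do rewrite big_cons.
by case: (Q i) => //; exact: bdd_measD.
Qed.

(** Only the trace of [A] on [X] has to be measurable; this suits preimages under iterates of a map
    that is measurable on [X] alone. *)
Lemma bdd_meas_indic A : measurable (X `&` A) -> bdd_meas (\1_A : U -> R).
Proof.
move=> mA; split; last first.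
  by exists 1 => x _; rewrite indicE; case: (_ \in _); rewrite ?normr1 ?normr0.
have : measurable_fun X (\1_(X `&` A) : U -> R) by exact: measurable_indic.
by apply: eq_measurable_fun => x Xx; rewrite indicI/= indicE Xx mul1r.
Qed.

Lemma expect_sum (I : Type) (s : seq I) (Q : pred I) (f : I -> U -> R) :
  (forall i, bdd_meas (f i)) ->
  E (fun x => \sum_(i <- s | Q i) f i x) = \sum_(i <- s | Q i) E (f i).
Proof.
move=> bf; elim: s => [|i s IH].
  rewrite big_nil; under eq_Rintegral do rewrite big_nil.
  by rewrite Rintegral_cst// mul0r.
rewrite big_cons; under eq_Rintegral do rewrite big_cons.
case: (Q i) => //; rewrite RintegralD ?IH//.
  exact: bdd_meas_integrable.
by apply: bdd_meas_integrable; exact: bdd_meas_sum.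
Qed.

Lemma expect_le f g : bdd_meas f -> bdd_meas g ->
  (forall x, X x -> f x <= g x) -> E f <= E g.
Proof. by move=> bf bg; apply: le_Rintegral => //; exact: bdd_meas_integrable. Qed.

Lemma expectD f g : bdd_meas f -> bdd_meas g ->
  E (fun x => f x + g x) = E f + E g.
Proof. by move=> bf bg; rewrite RintegralD//; exact: bdd_meas_integrable. Qed.

Lemma expectZ (c : R) f : bdd_meas f -> E (fun x => c * f x) = c * E f.
Proof. by move=> bf; rewrite RintegralZl//; exact: bdd_meas_integrable. Qed.

Lemma expect_indic A : measurable (X `&` A) -> E (\1_A) = fine (mu (X `&` A)).
Proof.
move=> mA; rewrite /Rintegral; congr fine.
under eq_integral => x Xx.
  have -> : \1_A x = \1_(X `&` A) x :> R by rewrite indicI/= [\1_X x]indicE Xx mul1r.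
  over.
by rewrite integral_indic// setIC setIA setIid.
Qed.

(* Chebyshev around the approximate mean [#|W| a] of the sum of the [Z w]. *)
Lemma second_moment (W : finType) (Z : W -> U -> R) (D : W -> W -> R) (a e : R) :
  mu X = 1%E -> 0 <= a ->
  (forall w, bdd_meas (Z w)) ->
  (forall w, a - e <= E (Z w)) ->
  (forall w w', E (fun x => Z w x * Z w' x) <= D w w') ->
  measurable (X `&` [set x | forall w, Z w x = 0]) ->
  fine (mu (X `&` [set x | forall w, Z w x = 0])) * (#|W|%:R * a) ^+ 2
    <= \sum_w \sum_w' D w w' - (#|W|%:R * a) ^+ 2 + 2 * #|W|%:R ^+ 2 * a * e.
Proof.
move=> X1 a0 bZ EZ EZZ mA; set A := [set x | _]; set m := #|W|%:R * a.
have m0 : 0 <= m by rewrite mulr_ge0.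
pose S x := \sum_w Z w x.
have bS : bdd_meas S by exact: bdd_meas_sum.
have bSS : bdd_meas (fun x => S x * S x) by exact: bdd_measM.
have bA : bdd_meas (\1_A : U -> R) by exact: bdd_meas_indic.
have bmA : bdd_meas (fun x => m ^+ 2 * \1_A x).
  by apply: bdd_measM => //; exact: bdd_meas_cst.
have bmS : bdd_meas (fun x => 2 * m * S x).
  by apply: bdd_measM => //; exact: bdd_meas_cst.
(* On [A], where [S] vanishes, both integrands equal [m ^+ 2]; off [A] their difference is the
   square [(S x - m) ^+ 2]. *)
have : E (fun x => m ^+ 2 * \1_A x + 2 * m * S x) <= E (fun x => S x * S x + m ^+ 2).
  apply: expect_le.
  - exact: bdd_measD.
  - by apply: bdd_measD => //; exact: bdd_meas_cst.
  - move=> x Xx; rewrite indicE; have [xA|xA] := boolP (x \in A).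
      have -> : S x = 0 by rewrite /S big1// => w _; move: xA; rewrite inE; apply.
      by rewrite mulr1 !mulr0 addr0 add0r.
    rewrite mulr0 add0r -subr_ge0.
    have -> : S x * S x + m ^+ 2 - 2 * m * S x = (S x - m) ^+ 2 by ring.
    exact: sqr_ge0.
rewrite expectD// expectZ// expectZ// expectD//; last exact: bdd_meas_cst.
rewrite Rintegral_cst// (congr1 fine X1 : fine _ = 1) mulr1 expect_indic//.
have ES : m - #|W|%:R * e <= E S.
  rewrite expect_sum// -mulrBr mulr_natl -sumr_const.
  by apply: ler_sum => w _; exact: EZ.
have ESS : E (fun x => S x * S x) <= \sum_w \sum_w' D w w'.
  have -> : E (fun x => S x * S x) =
      E (fun x => \sum_w \sum_w' Z w x * Z w' x).
    by apply: eq_Rintegral => x _; rewrite big_distrlr.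
  rewrite expect_sum; last first.
    by move=> w; apply: bdd_meas_sum => w'; exact: bdd_measM.
  apply: ler_sum => w _; rewrite expect_sum; last by move=> w'; exact: bdd_measM.
  exact: ler_sum.
set q := fine _ => H.
have mES : 2 * m * (m - #|W|%:R * e) <= 2 * m * E S.
  by apply: ler_wpM2l => //; rewrite mulr_ge0.
have -> : 2 * #|W|%:R ^+ 2 * a * e = 2 * m * (#|W|%:R * e) by rewrite /m; ring.
lra.
Qed.

End SecondMoment.

(** * Sums over pairs of intervals and pairs of times *)

(** [Q] and [Q'] stand for the correlations of two times inside the first and inside the second
    block. For far times a correlation is replaced by [p k * p l + e]; for near times only the row
    sums, at most [p k], are available. One near pair thus costs [p k * p l] times a correlation,
    which with [p l <= t] sums to [t ^+ 3]; two near pairs cost [p k * Q k l], which sums to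
    [t ^+ 2]. *)
Lemma pair_correlation_sum (R : realType) (K : finType) (S : {set K}) (p : K -> R)
    (t e : R) (Q Q' : K -> K -> R) (near near' : bool) :
  0 <= t -> 0 <= e -> \sum_(k in S) p k ^+ 2 = t ^+ 2 ->
  (forall k, 0 <= p k <= 1) ->
  (forall k l, 0 <= Q k l <= 1) -> (forall k l, 0 <= Q' k l <= p k) ->
  (forall k, \sum_(l in S) Q k l <= p k) ->
  (forall k, \sum_(l in S) Q' k l <= p k) ->
  (~~ near -> forall k l, Q k l <= p k * p l + e) ->
  (~~ near' -> forall k l, Q' k l <= p k * p l + e) ->
  \sum_(k in S) \sum_(l in S) (Q k l * Q' k l + e)
    <= t ^+ 4 + near%:R * t ^+ 3 + near'%:R * t ^+ 3
       + near%:R * near'%:R * t ^+ 2 + 3 * #|S|%:R ^+ 2 * e.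
Proof.
move=> t0 e0 St p01 Q01 Q'p SQ SQ' far far'.
have pt k : k \in S -> p k <= t.
  move=> kS; rewrite -(@ler_pXn2r _ 2)// ?nnegrE//; last by case/andP: (p01 k).
  rewrite -St (bigD1 k)//= lerDl; apply: sumr_ge0 => i _; exact: sqr_ge0.
have pointwise k l : l \in S -> Q k l * Q' k l + e <=
    p k ^+ 2 * p l ^+ 2 + near%:R * t * p k * Q k l + near'%:R * t * p k * Q' k l
    + near%:R * near'%:R * p k * Q k l + 3 * e.
  move=> lS; have lt := pt _ lS.
  have /andP[pk0 pk1] := p01 k; have /andP[pl0 pl1] := p01 l.
  have /andP[q0 q1] := Q01 k l; have /andP[q'0 q'p] := Q'p k l.
  have a0 : 0 <= p k ^+ 2 * p l ^+ 2 by rewrite mulr_ge0 ?sqr_ge0.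
  have tq : 0 <= t * p k * Q k l by rewrite !mulr_ge0.
  have tq' : 0 <= t * p k * Q' k l by rewrite !mulr_ge0.
  have pq : 0 <= p k * Q k l by rewrite mulr_ge0.
  have q'1 : Q' k l <= 1 by exact: le_trans q'p pk1.
  have eq : Q k l * e <= e by rewrite ler_piMl.
  have eq' : Q' k l * e <= e by rewrite ler_piMl.
  have pp : p k * p l <= p k * t by rewrite ler_wpM2l.
  have pp1 : p k * p l <= 1 by rewrite mulr_ile1.
  case: near far => far; case: near' far' => far'; rewrite ?mul1r ?mul0r ?addr0.
  - have := ler_wpM2l q0 q'p; lra.
  - have := ler_wpM2l q0 (far' isT k l); have := ler_wpM2l q0 pp; lra.
  - have := ler_wpM2l q'0 (far isT k l); have := ler_wpM2l q'0 pp; lra.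
  - have h1 := ler_wpM2l q0 (far' isT k l).
    have h2 := ler_wpM2l (mulr_ge0 pk0 pl0) (far isT k l).
    have h3 : p k * p l * e <= e by rewrite ler_piMl.
    lra.
have rowQ k (c : R) (F : K -> K -> R) : 0 <= c -> 
    (forall k, \sum_(l in S) F k l <= p k) ->
    \sum_(l in S) c * p k * F k l <= c * p k ^+ 2.
  move=> c0 SF; rewrite -mulr_sumr expr2 mulrA ler_wpM2l// mulr_ge0//.
  by case/andP: (p01 k).
have row k : \sum_(l in S) (Q k l * Q' k l + e) <=
    p k ^+ 2 * t ^+ 2 + near%:R * t * p k ^+ 2 + near'%:R * t * p k ^+ 2
    + near%:R * near'%:R * p k ^+ 2 + #|S|%:R * (3 * e).
  apply: (le_trans (ler_sum _ _)); first by move=> l; exact: pointwise.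
  rewrite !big_split/= -mulr_sumr St sumr_const -[_ *+ #|S|]mulr_natl.
  by do ![apply: lerD => //]; apply: rowQ => //; rewrite mulr_ge0.
apply: (le_trans (ler_sum _ _)); first by move=> k _; exact: row.
rewrite !big_split/= -mulr_suml -!mulr_sumr St sumr_const.
rewrite -[_ *+ #|S|]mulr_natl le_eqVlt; apply/orP; left; apply/eqP; ring.
Qed.

Lemma sum_near (R : realType) (N g : nat) :
  \sum_(i < N) \sum_(j < N) ((i < j + g) && (j < i + g))%N%:R <= (2 * g * N)%:R :> R.
Proof.
under eq_bigr do rewrite -natr_sum.
rewrite -natr_sum ler_nat.
have row (i : nat) : (\sum_(j < N) ((i < j + g) && (j < i + g)) <= 2 * g)%N.
  (* The indices [j] counted run from [i.+1 - g] up to [minn N (i + g)], excluded; the length of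
     this range is what the induction on [N] can carry. *)
  suff : (\sum_(j < N) ((i < j + g) && (j < i + g)) <= minn N (i + g) - (i.+1 - g))%N.
    by move/leq_trans; apply; lia.
  elim: N => [|n IH]; first by rewrite big_ord0.
  rewrite big_ord_recr/=; set s := (\sum_(_ < n) _)%N in IH *.
  by case: (boolP (_ && _)) => /=; lia.
rewrite (@leq_trans (\sum_(i < N) 2 * g)%N)//; first by apply: leq_sum => i _; exact: row.
by rewrite sum_nat_const card_ord mulnC.
Qed.

Lemma sum_indic_le1 (R : realType) (U : Type) (I : finType) (J : I -> set U)
    (S : {set I}) x :
  (forall k l x, J k x -> J l x -> k = l) -> \sum_(l in S) \1_(J l) x <= 1 :> R.
Proof.
move=> disjJ; have [[l Jl]|nJ] := pselect (exists l, J l x); last first.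
  rewrite big1// => l _; rewrite indicE; case: (boolP (_ \in _)) => //.
  by rewrite inE => Jl; case: nJ; exists l.
rewrite (@le_trans _ _ (\sum_l' (l' == l)%:R))//; last first.
  by rewrite (bigD1 l)//= eqxx big1 ?addr0// => l' /negbTE ->.
rewrite big_mkcond/=; apply: ler_sum => l' _; case: ifP => // _.
rewrite indicE ler_nat; case: (boolP (_ \in _)) => //.
by rewrite inE => /disjJ /(_ Jl) ->; rewrite eqxx.
Qed.

(** * Grids of intervals and the mass of balls *)

Section IntervalPartition.
Context {R : realType}.
Variables (mu : probability R R) (X : set R).
Hypotheses (mX : measurable X) (muX : mu X = 1%E).

Local Notation E h := (\int[mu]_(x in X) (h x)).

Lemma measure_setI_full A : measurable A -> mu (X `&` A) = mu A.
Proof.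
move=> mA; have X0 : mu (~` X) = 0%E by rewrite probability_setC// muX subee.
rewrite [RHS](measureDI mu mA mX) setIC [X in (X + _)%E](_ : _ = 0%E) ?add0e//.
apply/eqP; rewrite eq_le measure_ge0 andbT -X0.
apply: le_measure; rewrite ?inE; [exact: measurableD|exact: measurableC|].
by move=> x [].
Qed.

(** The balls are the sections of a strip around the diagonal of the plane, and the mass of a
    section depends measurably on the base point. *)
Lemma measurable_ball_mass (rho : R) : measurable_fun [set: R] (fun y : R => mu (ball y rho)).
Proof.
have mA : measurable [set z : R * R | `|z.1 - z.2| < rho].
  rewrite (_ : mkset _ = (fun z : R * R => `|z.1 - z.2|) @^-1` `]-oo, rho[%classic).
    rewrite -[X in measurable X]setTI.
    have mf : measurable_fun setT (fun z : R * R => `|z.1 - z.2|).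
      apply: measurableT_comp => //; apply: measurable_funB.
        exact: measurable_fst.
      exact: measurable_snd.
    exact: mf.
  by apply/seteqP; split => z /=; rewrite in_itv.
have := measurable_fun_xsection mu mA.
apply: eq_measurable_fun => y _ /=; congr (mu _).
by apply/seteqP; split => z; rewrite /xsection/= inE/=.
Qed.

(** Continuity of the measure from below; it reduces an unbounded [X] to finitely many grid
    cells. *)
Lemma exists_large_interval (rho delta : R) : 0 < rho -> 0 < delta ->
  exists H : nat, fine (mu (~` `[- (H%:R * rho), H%:R * rho[%classic)) <= delta.
Proof.
move=> rho0 delta0.
pose W (H : nat) : set R := `[- (H%:R * rho), H%:R * rho[%classic.
have cvgW : mu \o W @ \oo --> mu (\bigcup_H W H).
  apply: nondecreasing_cvg_mu.
  - by move=> H; exact: measurable_itv.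
  - by apply: bigcup_measurable => H _; exact: measurable_itv.
  - move=> H H' HH'; apply/subsetPset => x; rewrite /W/= !in_itv/= => /andP[a b].
    have h : H%:R * rho <= H'%:R * rho by rewrite ler_pM2r// ler_nat.
    apply/andP; split; [apply: le_trans a | apply: lt_le_trans b _] => //.
    by rewrite lerN2.
have WT : \bigcup_H W H = setT.
  rewrite -subTset => x _; exists (Num.trunc (`|x| / rho)).+1 => //.
  rewrite /W/= in_itv/=; apply/andP.
  have : `|x| < (Num.trunc (`|x| / rho)).+1%:R * rho.
    rewrite -ltr_pdivrMr//; exact: truncnS_gt.
  rewrite ltr_norml => /andP[/ltW ? ?]; by split.
rewrite WT probability_setT in cvgW.
have : \forall H \near \oo, ((1 - delta)%:E < mu (W H))%E.
  by apply: (cvgW [set z | (1 - delta)%:E < z]%E); apply: open_ereal_gt'; rewrite lte_fin; lra.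
move=> [H _ /(_ H (leqnn H))] /=; rewrite -/(W H) => HW; exists H.
have mW : measurable (W H) by exact: measurable_itv.
rewrite -/(W H) probability_setC//.
rewrite -(fineK (fin_num_measure mu _ mW)) -EFinB/= in HW *.
by rewrite lte_fin in HW; lra.
Qed.

(** Half-open cells are disjoint and leave no hole; the shift by [c] lets natural indices reach the
    [c] cells to the left of the origin. *)
Definition grid (rho : R) (c k : nat) : set R :=
  [set x | (k%:R - c%:R) * rho <= x < (k.+1%:R - c%:R) * rho].

Section Grid.
Variables (rho : R) (c : nat).
Hypothesis rho_gt0 : 0 < rho.

Lemma is_interval_grid k : is_interval (grid rho c k).
Proof.
move=> x y /andP[xa xb] /andP[ya yb] z /andP[xz zy]; apply/andP; split.
  exact: le_trans xa xz.
exact: le_lt_trans zy yb.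
Qed.

Lemma grid_disjoint k l x : grid rho c k x -> grid rho c l x -> k = l.
Proof.
wlog kl : k l / (k <= l)%N.
  by move=> H kx lx; have [/H|/ltnW/H H'] := leqP k l; [exact|exact/esym/H'].
move=> /andP[_ xb] /andP[ya _]; apply/eqP; rewrite eqn_leq kl/=.
have := le_lt_trans ya xb; rewrite ltr_pM2r// ltrD2r ltr_nat; lia.
Qed.

Lemma grid_dist_lt k x y : grid rho c k x -> grid rho c k y -> `|x - y| < rho.
Proof.
move=> /andP[xa xb] /andP[ya yb]; rewrite -natr1 in xb yb.
rewrite ltr_norml; apply/andP; split; lra.
Qed.

Lemma ball_sub_grid k y : grid rho c k.+1 y ->
  ball y rho `<=` grid rho c k `|` grid rho c k.+1 `|` grid rho c k.+2.
Proof.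
move=> /andP[ya yb] z; rewrite -ball_normE/= ltr_norml => /andP[za zb].
rewrite /grid/= in ya yb *; rewrite -!natr1 in ya yb *.
have [z1|z1] := ltP z ((k%:R + 1 - c%:R) * rho).
  by left; left; apply/andP; split => //; lra.
have [z2|z2] := ltP z ((k%:R + 1 + 1 - c%:R) * rho).
  by left; right; apply/andP; split.
by right; apply/andP; split => //; lra.
Qed.

Lemma grid_trunc y : - (c%:R * rho) <= y ->
  grid rho c (Num.trunc (y / rho + c%:R)) y.
Proof.
move=> yc; have y0 : 0 <= y / rho + c%:R.
  have : - c%:R <= y / rho by rewrite ler_pdivlMr// mulNr.
  lra.
have /andP[ya yb] := truncn_itv y0.
rewrite /grid/= -ler_pdivlMr// -ltr_pdivrMr//; apply/andP; split; lra.
Qed.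

End Grid.

Local Notation p rho c k := (E (\1_(grid rho c k))).

Lemma expect_grid rho c k : p rho c k = fine (mu (grid rho c k)).
Proof.
have mg : measurable (grid rho c k).
  by apply: is_interval_measurable; exact: is_interval_grid.
rewrite expect_indic ?measure_setI_full//; exact: measurableI.
Qed.

(** A ball of radius [rho] centred in a cell lies in that cell and its two neighbours, so the
    integral is bounded by products of masses of equal or adjacent cells, plus the mass outside a
    large window. *)
Lemma ball_mass_le (rho delta : R) : 0 < rho -> 0 < delta -> exists c m : nat,
  (\int[mu]_(y in X) mu (ball y rho) <=
    (3 * \sum_(k < m) p rho c k ^+ 2 + delta)%:E)%E.
Proof.
move=> rho0 delta0; have [H HW] := exists_large_interval rho delta rho0 delta0.
(* One spare cell on each side of the window [W] gives every cell inside it two neighbours. *)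
set W := `[_, _[%classic in HW; pose c := H.+1; exists c, (2 * H).+2.
have mW : measurable W by exact: measurable_itv.
have mg k : measurable (grid rho c k).
  by apply: is_interval_measurable; exact: is_interval_grid.
pose q k := p rho c k.
pose h y := \1_(~` W) y
  + \sum_(k < 2 * H) (q k + q k.+1 + q k.+2) * \1_(grid rho c k.+1) y : R.
have q0 k : 0 <= q k by apply: Rintegral_ge0 => x _; rewrite indicE.
have bsum (k : 'I_(2 * H)) : bdd_meas X (fun y => 
    (q k + q k.+1 + q k.+2) * \1_(grid rho c k.+1) y).
  apply: bdd_measM; first exact: bdd_meas_cst.
  by apply: bdd_meas_indic; exact: measurableI.
have bW : bdd_meas X (\1_(~` W) : R -> R).
  by apply: bdd_meas_indic; apply: measurableI => //; exact: measurableC.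
have bh : bdd_meas X h by apply: bdd_measD => //; exact: bdd_meas_sum.
have ih := bdd_meas_integrable mu X mX _ bh.
apply: (@le_trans _ _ (E h)%:E); last first.
  rewrite lee_fin expectD//; last exact: bdd_meas_sum.
  rewrite addrC; apply: lerD; last first.
    rewrite expect_indic ?measure_setI_full//; first exact: measurableC.
    by apply: measurableI => //; exact: measurableC.
  rewrite expect_sum//.
  under eq_bigr => k _.
    rewrite expectZ//; last by apply: bdd_meas_indic; exact: measurableI.
    over.
  have big2 (f : nat -> R) n : (forall k, 0 <= f k) ->
      \sum_(k < n) f k <= \sum_(k < n.+2) f k /\
      \sum_(k < n) f k.+1 <= \sum_(k < n.+2) f k /\
      \sum_(k < n) f k.+2 <= \sum_(k < n.+2) f k.
    move=> f0; split; [|split].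
    - by rewrite !big_ord_recr/= -addrA lerDl addr_ge0.
    - by rewrite big_ord_recl big_ord_recr/= addrCA lerDl addr_ge0.
    - by rewrite 2!big_ord_recl/= addrA lerDr addr_ge0.
  have [h1 [h2 h3]] := big2 (fun k => q k ^+ 2) (2 * H)%N (fun k => sqr_ge0 (q k)).
  rewrite -/q.
  (* Products of adjacent masses are split by [2 * x * y <= x ^+ 2 + y ^+ 2]; the coefficients 1/2,
     2 and 1/2 add up to 3. *)
  have : \sum_(k < 2 * H) (q k + q k.+1 + q k.+2) * q k.+1 <=
     2^-1 * \sum_(k < 2 * H) q k ^+ 2 + 2 * \sum_(k < 2 * H) q k.+1 ^+ 2
       + 2^-1 * \sum_(k < 2 * H) q k.+2 ^+ 2.
    rewrite !mulr_sumr -!big_split/=; apply: ler_sum => k _.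
    have := sqr_ge0 (q k - q k.+1); have := sqr_ge0 (q k.+1 - q k.+2); nra.
  by move=> /le_trans; apply; lra.
rewrite /Rintegral fineK; last exact: integrable_fin_num.
apply: ge0_le_integral => //.
- exact: measurable_funTS (measurable_ball_mass rho).
- by apply/measurable_EFinP; case: bh.
move=> y Xy; have mb : measurable (ball y rho) by exact: measurable_ball.
have [Wy|nWy] := pselect (W y); last first.
  rewrite (le_trans (probability_le1 mu mb))// lee_fin /h indicE mem_set//.
  by rewrite lerDl; apply: sumr_ge0 => k _; rewrite mulr_ge0// ?addr_ge0// indicE.
have := Wy; rewrite /W/= in_itv/= => /andP[yl yr].
have cy : - (c%:R * rho) <= y by apply: le_trans yl; rewrite /c -natr1; lra.
have := grid_trunc rho c rho0 y cy.
set k0 := Num.trunc _ => gy; have /andP[ga gb] := gy.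
have k0_gt0 : (0 < k0)%N.
  have : (- H%:R) * rho < (k0.+1%:R - c%:R) * rho.
    by rewrite mulNr; exact: le_lt_trans gb.
  by rewrite ltr_pM2r// /c -!natr1 -(ltr_nat R) => ?; lra.
have k0_le : (k0.-1 < 2 * H)%N.
  have : (k0%:R - c%:R) * rho < H%:R * rho by exact: le_lt_trans ga yr.
  rewrite ltr_pM2r// /c -natr1 => ?.
  rewrite prednK// -ltnS -(ltr_nat R) -natr1 natrM; lra.
pose k := Ordinal k0_le.
have k0E : k0 = k.+1 by rewrite /= prednK.
rewrite k0E in gy.
apply: (@le_trans _ _ (q k + q k.+1 + q k.+2)%:E).
  rewrite !EFinD /q !expect_grid !fineK ?fin_num_measure//.
  apply: (@le_trans _ _ (mu (grid rho c k `|` grid rho c k.+1 `|` grid rho c k.+2))).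
    apply: le_measure; rewrite ?inE//; first by do 2!apply: measurableU => //.
    exact: ball_sub_grid.
  apply: (le_trans (measureU2 _ _ _)) => //; first exact: measurableU.
  by rewrite leeD2r//; apply: measureU2.
have gy1 : \1_(grid rho c k.+1) y = 1 :> R by rewrite indicE mem_set.
rewrite lee_fin /h (bigD1 k)// addrCA gy1 mulr1 lerDl addr_ge0//.
by apply: sumr_ge0 => l _; rewrite mulr_ge0// !addr_ge0.
Qed.

(** The cells have total mass at most 1. Hence at most [delta^-1] of them weigh [delta] or more,
    however fine or long the grid, and the squares of the light ones sum to at most [delta]. Three
    times this loss and the [delta] of [ball_mass_le] make [4 * delta]. *)
Lemma exists_heavy_intervals (rho delta : R) : 0 < rho -> 0 < delta ->
  exists (m : nat) (J : 'I_m -> set R) (S : {set 'I_m}),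
  [/\ forall k, is_interval (J k), forall k l x, J k x -> J l x -> k = l,
      forall k x y, J k x -> J k y -> `|x - y| < rho,
      #|S|%:R * delta <= 1 &
      (\int[mu]_(y in X) mu (ball y rho) <=
        (3 * \sum_(k in S) E (\1_(J k)) ^+ 2 + 4 * delta)%:E)%E].
Proof.
move=> rho0 delta0; have [c [m Hm]] := ball_mass_le rho delta rho0 delta0.
pose J (k : 'I_m) := grid rho c k.
pose S := [set k : 'I_m | delta <= E (\1_(J k))]%SET.
have disjJ k l x : J k x -> J l x -> k = l.
  by move=> kx lx; apply/val_inj; exact: grid_disjoint kx lx.
have bJ k : bdd_meas X (\1_(J k) : R -> R).
  apply: bdd_meas_indic; apply: measurableI => //.
  by apply: is_interval_measurable; exact: is_interval_grid.
have J0 k : 0 <= E (\1_(J k)) by apply: Rintegral_ge0 => x _; rewrite indicE.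
have sum1 (S' : {set 'I_m}) : \sum_(k in S') E (\1_(J k)) <= 1.
  rewrite -(expect_sum _ _ _ _ _ _ (fun l => \1_(J l)))//.
  apply: (@le_trans _ _ (E (fun=> 1))); last first.
    by rewrite Rintegral_cst// (congr1 fine muX : fine _ = 1) mulr1.
  apply: expect_le => //; [exact: bdd_meas_sum|exact: bdd_meas_cst|].
  by move=> x _; exact: sum_indic_le1.
exists m, J, S; split => //.
- by move=> k; exact: is_interval_grid.
- by move=> k x y; exact: grid_dist_lt.
- rewrite mulr_natl -sumr_const; apply: le_trans (sum1 S).
  by apply: ler_sum => k; rewrite inE.
apply: (le_trans Hm); rewrite lee_fin.
rewrite (bigID (mem S))/=.
have : \sum_(k < m | k \notin S) E (\1_(J k)) ^+ 2 <= delta.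
  apply: (@le_trans _ _ (\sum_(k in (~: S)%SET) delta * E (\1_(J k)))).
    under [leRHS]eq_bigl do rewrite inE.
    apply: ler_sum => k; rewrite inE -ltNge => /ltW kd.
    by rewrite expr2 ler_wpM2r.
  by rewrite -mulr_sumr ler_piMr// ltW.
rewrite -/J; lra.
Qed.

End IntervalPartition.

(** * Telescoping bounds, Borel-Cantelli and auxiliary counting *)

(** The convex power of exponent [- eta] lies above its tangent at [v]; this follows from
    [1 + s <= expR s] and [ln s <= s - 1]. *)
Lemma powR_telescope (R : realType) (eta u v : R) : 0 < eta -> 0 < u -> 0 < v ->
  eta * v `^ (- (1 + eta)) * (v - u) <= u `^ (- eta) - v `^ (- eta).
Proof.
move=> eta0 u0 v0; have uv0 : 0 < u / v by rewrite divr_gt0.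
have split_u : u `^ (- eta) = v `^ (- eta) * expR (eta * - ln (u / v)).
  rewrite /powR !gt_eqF// -expRD lnM ?posrE ?invr_gt0// lnV ?posrE//.
  by congr expR; ring.
have split_v : v `^ (- (1 + eta)) = v `^ (- eta) / v.
  rewrite opprD addrC powRD; last by rewrite (gt_eqF v0) implybT.
  by rewrite powR_inv1 ?ltW.
have ve0 : 0 < v `^ (- eta) by exact: powR_gt0.
have ln_le : 1 - u / v <= - ln (u / v).
  have := @le_ln1Dx R (u / v - 1); rewrite addrCA subrr addr0 => /(_ ltac:(lra)); lra.
have exp_ge : 1 + eta * (1 - u / v) <= expR (eta * - ln (u / v)).
  by apply: le_trans (expR_ge1Dx _); rewrite lerD2l ler_pM2l.
rewrite split_u split_v.
have -> : eta * (v `^ (- eta) / v) * (v - u) = v `^ (- eta) * (eta * (1 - u / v)).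
  by field; rewrite gt_eqF.
rewrite -[X in _ <= _ - X]mulr1 -mulrBr ler_pM2l//; lra.
Qed.

(* The step from [m] to [m + 1] of the telescoping sum dominating the series
   of the [1 / (m ln m ^ (1 + eta))]. *)
Lemma inv_mul_lnX_telescope (R : realType) (eta a : R) (m : nat) : 0 < eta -> 0 < a ->
  (0 < m)%N -> 1 < m%:R * a ->
  eta * ((m.+1%:R * ln (m.+1%:R * a) `^ (1 + eta))^-1) <=
  ln (m%:R * a) `^ (- eta) - ln (m.+1%:R * a) `^ (- eta).
Proof.
move=> eta0 a0 m0 ma1.
have m0R : 0 < m%:R :> R by rewrite ltr0n.
have mS : m.+1%:R = m%:R + 1 :> R by rewrite -natr1.
have u0 : 0 < ln (m%:R * a) by exact: ln_gt0.
have v0 : 0 < ln (m.+1%:R * a).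
  by apply: ln_gt0; apply: (lt_trans ma1); rewrite ltr_pM2r// ltr_nat.
apply: le_trans (powR_telescope _ _ _ _ eta0 u0 v0).
rewrite -mulrA ler_pM2l// invfM -powRN mulrC ler_pM2l ?powR_gt0//.
rewrite !lnM ?posrE ?ltr0n// opprD addrACA subrr addr0.
have -> : ln m.+1%:R - ln m%:R = - ln (m%:R / m.+1%:R) :> R.
  by rewrite lnM ?posrE ?invr_gt0 ?ltr0n// lnV ?posrE ?ltr0n//; ring.
have := @le_ln1Dx R (- m.+1%:R^-1).
have i1 : m.+1%:R^-1 < 1 :> R by rewrite invf_lt1 ?ltr0n// ltr1n.
have -> : 1 + - m.+1%:R^-1 = m%:R / m.+1%:R :> R.
  by rewrite mS; field; rewrite -mS gt_eqF ?ltr0n.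
by rewrite ltrN2 i1 lerNr => /(_ isT).
Qed.

(** Borel-Cantelli: the partial sums of the masses telescope and, [u] being nonnegative, never
    exceed [u 0]. *)
Lemma lim_sup_set_telescope (d : measure_display) (U : measurableType d) (R : realType)
    (mu : {measure set U -> \bar R}) (F : nat -> set U) (u : nat -> R) :
  (forall n, measurable (F n)) -> (forall n, 0 <= u n) ->
  (forall n, (mu (F n) <= (u n - u n.+1)%:E)%E) -> mu (lim_sup_set F) = 0%E.
Proof.
move=> mF u0 muF; apply: lim_sup_set_cvg0 => //.
apply: (@le_lt_trans _ _ (u 0%N)%:E); last exact: ltry.
apply: lime_le; first by apply: is_cvg_nneseries.
apply: nearW => n.
apply: (@le_trans _ _ (\sum_(0 <= k < n) (u k - u k.+1)%:E)%E).
  by apply: lee_sum => k _; exact: muF.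
rewrite sumEFin lee_fin.
suff -> : \sum_(0 <= k < n) (u k - u k.+1) = u 0%N - u n by rewrite lerBlDr lerDl.
elim: n => [|n IH]; first by rewrite big_geq// subrr.
by rewrite big_nat_recr//= IH; ring.
Qed.

(** Ensures that at all late scales two blocks of length [2 ^ k] and the gap [c * (k + 3)] fit below
    [2 ^ (k + 2)]. *)
Lemma linear_le_exp2 (c : nat) :
  exists k0, forall k, (k0 <= k -> c * (k + 3) <= 2 ^ k.+1)%N.
Proof.
exists (2 * c + 4)%N => k.
elim: k => [|k IH]; first by rewrite leqn0 addn_eq0 andbF.
rewrite leq_eqVlt => /orP[/eqP kE|/IH]; last first.
  move=> H; have : (c <= 2 ^ k.+1)%N by apply: leq_trans H; rewrite leq_pmulr// addn_gt0 orbT.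
  by rewrite (expnS 2 k.+1); lia.
(* Start of the induction, at the index [2 * c + 4]: squaring [c < 2 ^ c] controls the quadratic
   [c * (2 * c + 7)]. *)
have := ltn_expl c (isT : 1 < 2)%N => H.
rewrite -kE.
have -> : (2 ^ (2 * c + 4).+1 = 32 * (2 ^ c * 2 ^ c))%N.
  by rewrite -expnD -(expnD 2 5); congr (_ ^ _)%N; lia.
have := leq_mul H H; nia.
Qed.

(** With [w] and [w'] pairs of times, it separates the sum over first-block times from the sum over
    second-block times. *)
Lemma sum_prod_pairs (R : pzRingType) (I : finType) (F G : I -> I -> R) :
  \sum_(w : I * I) \sum_(w' : I * I) F w.1 w'.1 * G w.2 w'.2 =
  (\sum_i \sum_i' F i i') * (\sum_j \sum_j' G j j').
Proof.
rewrite big_distrlr/= -(pair_bigA _ (fun i j => \sum_(w' : I * I) F i w'.1 * G j w'.2))/=.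
apply: eq_bigr => i _; apply: eq_bigr => j _.
rewrite -(pair_bigA _ (fun i' j' => F i i' * G j j'))/= big_distrlr/=.
by [].
Qed.

Lemma indic_preimage (U V : Type) (R : pzRingType) (f : U -> V) (A : set V) x :
  \1_(f @^-1` A) x = \1_A (f x) :> R.
Proof. by []. Qed.

(** * Stationarity and decorrelation of the iterates *)

Section Dynamics.
Context {R : realType}.
Variables (mu : probability R R) (X : set R) (T : R -> R) (theta K : R).
Hypotheses (mX : measurable X) (muX : mu X = 1%E).
Hypotheses (TX : forall x, X x -> X (T x)) (mT : measurable_fun X T).
Hypothesis invT : forall A, measurable A -> mu (X `&` T @^-1` A) = mu A.
Hypothesis theta_gt0 : 0 < theta.
Hypothesis mixT : forall I1 I2 I3 I4 : set R,
  is_interval I1 -> is_interval I2 -> is_interval I3 -> is_interval I4 ->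
  mix4_bound mu X T theta K (\1_I1) (\1_I2) (\1_I3) (\1_I4).

Local Notation E h := (\int[mu]_(x in X) (h x)).
Local Notation chi A i := (fun x : R => \1_A (iter i T x) : R).

Lemma iter_stable i x : X x -> X (iter i T x).
Proof. by elim: i => //= i IH /IH; exact: TX. Qed.

Lemma measurable_iter i : measurable_fun X (iter i T).
Proof.
elim: i => [|i IH]; first exact: measurable_id.
apply: (measurable_comp mX _ mT IH) => _ [x Xx <-].
exact: iter_stable.
Qed.

Lemma measurable_preimage_iter i A : measurable (X `&` A) ->
  measurable (X `&` iter i T @^-1` A).
Proof.
move=> mA; have := measurable_iter i mX _ mA; congr measurable.
apply/seteqP; split => x /= [Xx]; first by case.
by move=> Ax; split => //; split => //; exact: iter_stable.
Qed.

Lemma measure_preimage_iter i A : measurable (X `&` A) ->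
  mu (X `&` iter i T @^-1` A) = mu (X `&` A).
Proof.
move=> mA; elim: i => // i <-; rewrite -[RHS]invT; last first.
  exact: measurable_preimage_iter.
congr (mu _); apply/seteqP; split => x /= [Xx]; rewrite -iterSr iterS.
  by move=> ?; split => //; split => //; exact: TX.
by case.
Qed.

Lemma expect_shift i A : measurable (X `&` A) -> E (chi A i) = E (\1_A).
Proof.
move=> mA; have mTA := measurable_preimage_iter i A mA.
rewrite -[LHS]/(E (\1_(iter i T @^-1` A))) !expect_indic//.
by congr fine; exact: measure_preimage_iter.
Qed.

Lemma measurable_itv_in A : is_interval A -> measurable (X `&` A).
Proof. by move=> iA; apply: measurableI => //; exact: is_interval_measurable. Qed.

Lemma bdd_meas_chi A i : is_interval A -> bdd_meas X (chi A i).
Proof.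
move=> iA; apply: (@bdd_meas_indic _ _ _ X (iter i T @^-1` A)).
by apply: measurable_preimage_iter; exact: measurable_itv_in.
Qed.

(** Mixing is stated with its first factor at time 0. The product is the indicator of a single set
    pulled back along [i] iterates, so invariance moves the earliest time to 0. *)
Lemma expect_shift2 A B i i' : is_interval A -> is_interval B -> (i <= i')%N ->
  E (fun x => chi A i x * chi B i' x) = E (fun x => \1_A x * chi B (i' - i) x).
Proof.
move=> iA iB ii'; pose G := A `&` (iter (i' - i) T @^-1` B).
have mG : measurable (X `&` G).
  by rewrite /G setIIr; apply: measurableI; [exact: measurable_itv_in|
    apply: measurable_preimage_iter; exact: measurable_itv_in].
transitivity (E (chi G i)).
  by apply: eq_Rintegral => x _; rewrite /G indicI/= [in RHS]indic_preimage -iterD subnK.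
rewrite expect_shift//.
by apply: eq_Rintegral => x _; rewrite /G indicI.
Qed.

Lemma expect_shift4 A B C D i i' j j' : is_interval A -> is_interval B ->
  is_interval C -> is_interval D -> (i <= i')%N -> (i <= j)%N -> (i <= j')%N ->
  E (fun x => chi A i x * chi B i' x * chi C j x * chi D j' x) =
  E (fun x => \1_A x * chi B (i' - i) x * chi C (j - i) x * chi D (j' - i) x).
Proof.
move=> iA iB iC iD ii' ij ij'.
have mchi H k : is_interval H -> measurable (X `&` iter k T @^-1` H).
  by move=> iH; apply: measurable_preimage_iter; exact: measurable_itv_in.
pose G := A `&` (iter (i' - i) T @^-1` B) `&` (iter (j - i) T @^-1` C)
            `&` (iter (j' - i) T @^-1` D).
have mG : measurable (X `&` G).
  rewrite /G; do 3![rewrite setIIr; apply: measurableI; last exact: mchi].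
  exact: measurable_itv_in.
transitivity (E (chi G i)).
  apply: eq_Rintegral => x _; rewrite /G !indicI/= !indic_preimage.
  by rewrite -!iterD !subnK.
rewrite expect_shift//.
by apply: eq_Rintegral => x _; rewrite /G !indicI.
Qed.

(** The absolute value makes the error nonnegative and nonincreasing in [g] whatever the sign of
    [K]. *)
Definition mix_err g : R := `|K| * expR (- (theta * g%:R)).

Lemma mix_err_ge0 g : 0 <= mix_err g.
Proof. by rewrite mulr_ge0// expR_ge0. Qed.

Lemma mix_err_ge g n : (g <= n)%N -> K * expR (- (theta * n%:R)) <= mix_err g.
Proof.
move=> gn; apply: (@le_trans _ _ (`|K| * expR (- (theta * n%:R)))).
  by rewrite ler_wpM2r ?expR_ge0 ?ler_norm.
by rewrite ler_wpM2l// ler_expR lerN2 ler_pM2l// ler_nat.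
Qed.

Lemma decorrelate4_ordered A B C D i i' j j' g : is_interval A -> is_interval B ->
  is_interval C -> is_interval D -> (0 < g)%N ->
  (i <= i')%N -> (j <= j')%N -> (i' + g <= j)%N ->
  E (fun x => chi A i x * chi B i' x * chi C j x * chi D j' x) <=
  E (fun x => chi A i x * chi B i' x) * E (fun x => chi C j x * chi D j' x)
    + mix_err g.
Proof.
move=> iA iB iC iD g0 ii' jj' i'j.
rewrite expect_shift4//; try lia.
rewrite [in leRHS](expect_shift2 A)// (expect_shift2 C)//.
(* Counted from the earliest time [i], the mixing times are [i' - i], [j - i] and [j' - i]; the
   decay is governed by [j - i'], the distance between the two pairs. *)
have := mixT A B C D iA iB iC iD (i' - i)%N (j - i)%N (j' - i)%N.
have -> : (j' - i - (j - i) = j' - j)%N by lia.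
have -> : (j - i - (i' - i) = j - i')%N by lia.
move=> /(_ ltac:(lia) ltac:(lia)); rewrite ler_distl => /andP[_].
move=> /le_trans; apply; rewrite lerD2l; apply: mix_err_ge; lia.
Qed.

(** The product is symmetric within each pair of times, so each pair may be put in increasing order
    separately. *)
Lemma decorrelate4 A B C D i i' j j' g : is_interval A -> is_interval B ->
  is_interval C -> is_interval D -> (0 < g)%N ->
  (i + g <= j)%N -> (i' + g <= j)%N -> (i + g <= j')%N -> (i' + g <= j')%N ->
  E (fun x => chi A i x * chi B i' x * chi C j x * chi D j' x) <=
  E (fun x => chi A i x * chi B i' x) * E (fun x => chi C j x * chi D j' x)
    + mix_err g.
Proof.
move=> iA iB iC iD g0 ij i'j ij' i'j'.
wlog ii' : A B i i' iA iB ij i'j ij' i'j' / (i <= i')%N.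
  move=> H; have [/H|/ltnW /H] := leqP i i'; first exact.
  move=> /(_ B A iB iA i'j ij i'j' ij').
  under eq_Rintegral do rewrite [_ (iter i' T _) * _]mulrC.
  by under [X in _ <= X * _ + _]eq_Rintegral do rewrite mulrC.
wlog jj' : C D j j' iC iD ij i'j ij' i'j' / (j <= j')%N.
  move=> H; have [/H|/ltnW /H] := leqP j j'; first exact.
  move=> /(_ D C iD iC ij' i'j' ij i'j).
  under eq_Rintegral do rewrite mulrAC.
  by under [X in _ <= _ * X + _]eq_Rintegral do rewrite mulrC.
exact: decorrelate4_ordered.
Qed.

Lemma decorrelate2 A B i j g : is_interval A -> is_interval B -> (0 < g)%N ->
  (i + g <= j)%N || (j + g <= i)%N ->
  `|E (fun x => chi A i x * chi B j x) - E (\1_A) * E (\1_B)| <= mix_err g.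
Proof.
move=> iA iB g0 far; have iT : is_interval [set: R] by [].
wlog ij : A B i j iA iB {far} / (i + g <= j)%N.
  move=> H; case/orP: far => [/H|/H]; first exact.
  move=> /(_ B A iB iA); rewrite [E (\1_B) * _]mulrC.
  by under eq_Rintegral do rewrite mulrC.
rewrite expect_shift2//; last lia.
(* The whole line is an interval with indicator 1. Taking it for the second and fourth factors, with
   [a = 0] and [b = c], turns four-fold mixing into two-fold mixing. *)
have := mixT A setT B setT iA iT iB iT 0%N (j - i)%N (j - i)%N.
move=> /(_ ltac:(lia) ltac:(lia)); rewrite subnn subn0/=.
have one y : \1_(@setT R) y = 1 :> R by rewrite indicE in_setT.
under eq_Rintegral do rewrite !one !mulr1.
under [X in _ - X * _]eq_Rintegral do rewrite one mulr1.
under [X in _ - _ * X]eq_Rintegral do rewrite one mulr1.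
by move=> /le_trans; apply; apply: mix_err_ge; lia.
Qed.

(** * Encounters between two blocks of times *)

Section Hitting.
Variables (I : finType) (J : I -> set R) (S : {set I}) (N g : nat).
Hypothesis itvJ : forall k, is_interval (J k).
Hypothesis disjJ : forall k l x, J k x -> J l x -> k = l.
Hypothesis g_gt0 : (0 < g)%N.

Let p k := E (\1_(J k)).
(** For disjoint [J k], [t ^+ 2] is the probability that two independent points of law [mu] share an
    interval of [S]. The root is named because near pairs contribute the odd power [t ^+ 3]. *)
Let t := Num.sqrt (\sum_(k in S) p k ^+ 2).

Let p01 k : 0 <= p k <= 1.
Proof.
apply/andP; split; first by apply: Rintegral_ge0 => x _; rewrite indicE.
rewrite /p expect_indic//; last exact: measurable_itv_in.
rewrite -lee_fin fineK ?fin_num_measure//; last exact: measurable_itv_in.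
by apply: probability_le1; exact: measurable_itv_in.
Qed.

Let expect_chi k i : E (chi (J k) i) = p k.
Proof. by apply: expect_shift; exact: measurable_itv_in. Qed.

Let Q i i' k l := E (fun x => chi (J k) i x * chi (J l) i' x).

Let bdd_chi2 k l i i' : bdd_meas X (fun x => chi (J k) i x * chi (J l) i' x).
Proof. by apply: bdd_measM; exact: bdd_meas_chi. Qed.

Let Qp i i' k l : 0 <= Q i i' k l <= p k.
Proof.
apply/andP; split.
  by apply: Rintegral_ge0 => x _; rewrite mulr_ge0.
rewrite -(expect_chi k i); apply: expect_le => //; first exact: bdd_meas_chi.
by move=> x _; rewrite ler_piMr// indicE// lern1 leq_b1.
Qed.

Let sum_chi_le1 i x : \sum_(l in S) chi (J l) i x <= 1.
Proof. exact: sum_indic_le1. Qed.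

Let sum_Q i i' k : \sum_(l in S) Q i i' k l <= p k.
Proof.
rewrite -(expect_sum _ _ _ _ _ _ (fun l x => chi (J k) i x * chi (J l) i' x))//.
rewrite -(expect_chi k i); apply: expect_le => //.
- exact: bdd_meas_sum.
- exact: bdd_meas_chi.
- by move=> x _; rewrite -mulr_sumr ler_piMr// sum_chi_le1.
Qed.

(** Times of different blocks are more than [g] apart, so strong dependence can only occur between
    times of the same block. Disjointness of the [J k] makes the value 0 or 1. *)
Definition encounters (w : 'I_N * 'I_N) (x : R) : R :=
  \sum_(k in S) chi (J k) w.1 x * chi (J k) (N + g + w.2) x.

Definition no_encounter : set R := [set x | forall w, encounters w x = 0].

Let bdd_enc w : bdd_meas X (encounters w).
Proof. by apply: bdd_meas_sum => k; apply: bdd_measM; exact: bdd_meas_chi. Qed.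

Let enc_ge0 w x : 0 <= encounters w x.
Proof. by apply: sumr_ge0 => k _; rewrite mulr_ge0. Qed.

Lemma measurable_no_encounter : measurable (X `&` no_encounter).
Proof.
have [mS _] : bdd_meas X (fun x => \sum_w encounters w x) by exact: bdd_meas_sum.
have := mS mX [set 0] (measurable_set1 0); congr measurable.
apply/seteqP; split => x [Xx /= H]; split => //=; last by rewrite big1.
by move=> w; apply: (psumr_eq0P _ H).
Qed.

Lemma no_encounterP x : X x -> ~ no_encounter x ->
  exists i j k, [/\ (i < j)%N, (j < 2 * N + g)%N, J k (iter i T x) & J k (iter j T x)].
Proof.
move=> Xx /existsNP[w]; rewrite /encounters => /eqP.
rewrite psumr_neq0; last by move=> k _; rewrite mulr_ge0.
move=> /hasP[k _ /andP[_]].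
rewrite !indicE -natrM mulnb ltr0n lt0b => /andP[]; rewrite !inE => Ji Jj.
exists w.1, (N + g + w.2)%N, k; split => //.
  by have := ltn_ord w.1; lia.
by have := ltn_ord w.2; lia.
Qed.

Let e := mix_err g.
Let near (i i' : nat) := ((i < i' + g) && (i' < i + g))%N.

Let expect_encounters w : t ^+ 2 - #|S|%:R * e <= E (encounters w).
Proof.
rewrite expect_sum// sqr_sqrtr; last by apply: sumr_ge0 => k _; exact: sqr_ge0.
rewrite mulr_natl -sumr_const -sumrB; apply: ler_sum => k _.
have := decorrelate2 (J k) (J k) w.1 (N + g + w.2) g (itvJ k) (itvJ k) g_gt0.
have := ltn_ord w.1 => ? /(_ ltac:(lia)).
by rewrite ler_distl expr2 => /andP[].
Qed.

Let far_Q i i' : ~~ near i i' -> forall k l, Q i i' k l <= p k * p l + e.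
Proof.
move=> far k l.
have := decorrelate2 (J k) (J l) i i' g (itvJ k) (itvJ l) g_gt0.
rewrite /near in far => /(_ ltac:(lia)).
by rewrite ler_distl => /andP[].
Qed.

(** The four factors are regrouped by block instead of by encounter; the gap decouples the blocks by
    [decorrelate4], and [pair_correlation_sum] handles the correlations inside each block. *)
Let expect_encounters2 w w' :
  E (fun x => encounters w x * encounters w' x) <=
  t ^+ 4 + (near w.1 w'.1)%:R * t ^+ 3 + (near w.2 w'.2)%:R * t ^+ 3
    + (near w.1 w'.1)%:R * (near w.2 w'.2)%:R * t ^+ 2 + 3 * #|S|%:R ^+ 2 * e.
Proof.
have -> : near w.2 w'.2 = near (N + g + w.2) (N + g + w'.2) by rewrite /near; lia.
apply: le_trans (pair_correlation_sum _ _ S p t e (Q w.1 w'.1)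
  (Q (N + g + w.2) (N + g + w'.2)) _ _ _ _ _ _ _ _ _ _ _ _) => //; last first.
- exact: far_Q.
- exact: far_Q.
- move=> k l; have /andP[-> H] := Qp w.1 w'.1 k l; apply: (le_trans H).
  by case/andP: (p01 k).
- by rewrite sqr_sqrtr//; apply: sumr_ge0 => k _; exact: sqr_ge0.
- exact: mix_err_ge0.
- exact: sqrtr_ge0.
have -> : E (fun x => encounters w x * encounters w' x) =
    E (fun x => \sum_(k in S) \sum_(l in S)
      chi (J k) w.1 x * chi (J l) w'.1 x *
      chi (J k) (N + g + w.2) x * chi (J l) (N + g + w'.2) x).
  apply: eq_Rintegral => x _; rewrite big_distrlr/=.
  by apply: eq_bigr => k _; apply: eq_bigr => l _; rewrite mulrACA !mulrA.
have b4 k l : bdd_meas X (fun x =>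
      chi (J k) w.1 x * chi (J l) w'.1 x *
      chi (J k) (N + g + w.2) x * chi (J l) (N + g + w'.2) x).
  by do 2![apply: bdd_measM; last exact: bdd_meas_chi].
rewrite expect_sum//; last by move=> k; apply: bdd_meas_sum.
apply: ler_sum => k _; rewrite expect_sum//; apply: ler_sum => l _.
by apply: decorrelate4 => //; have := ltn_ord w.1; have := ltn_ord w'.1; lia.
Qed.

(** In [second_moment] the leading term, the fourth power of [N%:R * t], cancels. Each block has at
    most [2 * g * N] near pairs of times: one near pair gives the cubic term, two give the quadratic
    one. *)
Lemma no_encounter_bound :
  fine (mu (X `&` no_encounter)) * (N%:R * t) ^+ 4 <=
  4 * g%:R * (N%:R * t) ^+ 3 + 4 * g%:R ^+ 2 * (N%:R * t) ^+ 2
    + 5 * N%:R ^+ 4 * #|S|%:R ^+ 2 * e.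
Proof.
have := second_moment _ _ _ _ encounters _ (t ^+ 2) (#|S|%:R * e) muX _ bdd_enc
  expect_encounters expect_encounters2 measurable_no_encounter.
rewrite sqr_ge0 => /(_ mX isT); rewrite -/no_encounter card_prod card_ord natrM.
set q := fine _; set n : R := N%:R; set G : R := g%:R; set s : R := #|S|%:R.
pose nearR (i i' : 'I_N) : R := (near i i')%:R.
pose B := \sum_i \sum_i' nearR i i'.
have B_le : B <= 2 * G * n by have := sum_near R N g; rewrite !natrM.
have B_ge0 : 0 <= B by apply: sumr_ge0 => i _; apply: sumr_ge0.
have ones : \sum_(i < N) \sum_(i' < N) 1 = n ^+ 2 :> R.
  by rewrite !sumr_const card_ord -mulrnA expr2 -natrM.
have -> : \sum_(w : 'I_N * 'I_N) \sum_(w' : 'I_N * 'I_N) (t ^+ 4 + (near w.1 w'.1)%:R * t ^+ 3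
      + (near w.2 w'.2)%:R * t ^+ 3
      + (near w.1 w'.1)%:R * (near w.2 w'.2)%:R * t ^+ 2 + 3 * s ^+ 2 * e) =
    n ^+ 4 * t ^+ 4 + 2 * B * n ^+ 2 * t ^+ 3 + B ^+ 2 * t ^+ 2
      + 3 * n ^+ 4 * s ^+ 2 * e :> R.
  have S1 := sum_prod_pairs R 'I_N nearR (fun _ _ => 1).
  have S2 := sum_prod_pairs R 'I_N (fun _ _ => 1) nearR.
  have S3 := sum_prod_pairs R 'I_N nearR nearR.
  have S4 := sum_prod_pairs R 'I_N (fun _ _ => 1) (fun _ _ => 1).
  rewrite -/B ones in S1 S2 S3 S4.
  transitivity (n ^+ 2 * n ^+ 2 * t ^+ 4 + B * n ^+ 2 * t ^+ 3 + n ^+ 2 * B * t ^+ 3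
    + B * B * t ^+ 2 + n ^+ 2 * n ^+ 2 * (3 * s ^+ 2 * e)); last by ring.
  rewrite -S1 -S2 -S3 -S4 !mulr_suml -!big_split/=; apply: eq_bigr => w _.
  rewrite !mulr_suml -!big_split/=; apply: eq_bigr => w' _.
  by rewrite !mulr1 !mul1r.
have t0 : 0 <= t by exact: sqrtr_ge0.
have e0 : 0 <= e by exact: mix_err_ge0.
have n0 : 0 <= n by []. have s0 : 0 <= s by []. have G0 : 0 <= G by [].
(* In units of [n ^+ 4 * e], the mean contributes an error [2 * t ^+ 2 * s] and the second moment
   [3 * s ^+ 2]. As [s] is a natural number and [t ^+ 2 <= 1], they add up to at most
   [5 * s ^+ 2]. *)
have ss : s <= s ^+ 2.
  by rewrite /s -natrX ler_nat; case: #|S| => // m; rewrite -[leqLHS]muln1 leq_mul.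
have t1 : t ^+ 2 <= 1.
  rewrite sqr_sqrtr; last by apply: sumr_ge0 => k _; exact: sqr_ge0.
  rewrite (@le_trans _ _ (\sum_(k in S) E (chi (J k) 0)))//.
    apply: ler_sum => k _; rewrite expect_chi; have /andP[p0 p1] := p01 k.
    by rewrite expr2 ler_piMr.
  rewrite -(expect_sum _ _ _ _ _ _ (fun l x => chi (J l) 0 x))//; last first.
    by move=> k; exact: bdd_meas_chi.
  rewrite (@le_trans _ _ (E (fun=> 1)))//; last first.
    by rewrite Rintegral_cst// (congr1 fine muX : fine _ = 1) mulr1.
  apply: expect_le => //.
  - by apply: bdd_meas_sum => k; exact: bdd_meas_chi.
  - exact: bdd_meas_cst.
have h1 : 2 * B * n ^+ 2 * t ^+ 3 <= 4 * G * (n * t) ^+ 3.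
  have -> : 4 * G * (n * t) ^+ 3 = 2 * (n ^+ 2 * t ^+ 3) * (2 * G * n) by ring.
  have -> : 2 * B * n ^+ 2 * t ^+ 3 = 2 * (n ^+ 2 * t ^+ 3) * B by ring.
  by rewrite ler_wpM2l// !mulr_ge0// exprn_ge0.
have h2 : B ^+ 2 * t ^+ 2 <= 4 * G ^+ 2 * (n * t) ^+ 2.
  have -> : 4 * G ^+ 2 * (n * t) ^+ 2 = (2 * G * n) ^+ 2 * t ^+ 2 by ring.
  rewrite ler_wpM2r ?exprn_ge0// ler_pXn2r// nnegrE !mulr_ge0//.
have h3 : 2 * n ^+ 4 * t ^+ 2 * (s * e) <= 2 * n ^+ 4 * (s ^+ 2 * e).
  rewrite -mulrA ler_wpM2l ?mulr_ge0 ?exprn_ge0//.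
  rewrite -[leRHS]mul1r ler_pM ?exprn_ge0 ?mulr_ge0//.
  by rewrite ler_wpM2r.
have -> : (n * n * t ^+ 2) ^+ 2 = (n * t) ^+ 4 by ring.
have -> : n ^+ 4 * t ^+ 4 = (n * t) ^+ 4 by ring.
have -> : 2 * (n * n) ^+ 2 * t ^+ 2 * (s * e) = 2 * n ^+ 4 * t ^+ 2 * (s * e) by ring.
move=> H; move: (h1) (h2) (h3); lra.
Qed.

End Hitting.

(** * Exceptional sets at a single scale *)

(** [b] is a lower bound for [N%:R * t], since the heavy intervals satisfy
    [t ^+ 2 >= (Y - 4 * delta) / 3]. Dividing [no_encounter_bound] by the fourth power of [N%:R * t]
    leaves terms that decrease in it, and [delta^-1] bounds the number of intervals. *)
Lemma exists_rare_set (rho delta Y b : R) (N g : nat) :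
  0 < rho -> 0 < delta -> (0 < g)%N -> 0 < b ->
  b ^+ 2 <= N%:R ^+ 2 * ((Y - 4 * delta) / 3) ->
  (Y%:E <= \int[mu]_(y in X) mu (ball y rho))%E ->
  exists A, [/\ measurable A,
    (mu A <= (4 * (g%:R / b) + 4 * (g%:R / b) ^+ 2
              + 5 * (N%:R ^+ 4 * delta^-1 ^+ 2 * mix_err g) / b ^+ 4)%:E)%E &
    forall x, X x -> ~ A x -> exists i j : nat,
      (i < j < 2 * N + g)%N /\ `|iter i T x - iter j T x| < rho].
Proof.
move=> rho0 delta0 g0 b0 bY YX.
have [m [J [S [itvJ disjJ diamJ cardS massS]]]] :=
  exists_heavy_intervals mu X mX muX rho delta rho0 delta0.
exists (X `&` no_encounter 'I_m J S N g); split.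
- exact: measurable_no_encounter.
- rewrite -(fineK (fin_num_measure mu _ _)); last exact: measurable_no_encounter.
  rewrite lee_fin.
  have := no_encounter_bound 'I_m J S N g itvJ disjJ g0.
  set q := fine _; set M := \sum_(k in S) _ in massS *; set t := Num.sqrt M.
  set e := mix_err g; set s := #|S|%:R in cardS *; set G : R := g%:R.
  have e0 : 0 <= e by exact: mix_err_ge0.
  have M0 : 0 <= M by apply: sumr_ge0 => k _; exact: sqr_ge0.
  have /(le_trans YX) := massS; rewrite lee_fin => YM.
  have y2 : b ^+ 2 <= (N%:R * t) ^+ 2.
    rewrite exprMn sqr_sqrtr//; apply: (le_trans bY).
    by rewrite ler_wpM2l ?sqr_ge0//; lra.
  set y := N%:R * t in y2 *.
  have y0 : 0 <= y by rewrite mulr_ge0// sqrtr_ge0.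
  have yb : b <= y by rewrite -(@ler_pXn2r _ 2)// nnegrE ltW.
  have y_gt0 : 0 < y by exact: lt_le_trans yb.
  move=> H.
  have sd : s <= delta^-1 by rewrite -[leRHS]mul1r ler_pdivlMr.
  have {H} : q <= 4 * (G / y) + 4 * (G / y) ^+ 2 + 5 * (N%:R ^+ 4 * s ^+ 2 * e) / y ^+ 4.
    rewrite -(ler_pM2r (exprn_gt0 4 y_gt0)); apply: (le_trans H).
    rewrite le_eqVlt; apply/orP; left; apply/eqP; field; exact: lt0r_neq0.
  move=> /le_trans; apply.
  have Gyb : G / y <= G / b by rewrite ler_wpM2l// lef_pV2.
  have Gy0 : 0 <= G / y by rewrite divr_ge0.
  apply: lerD; first apply: lerD.
  + by rewrite ler_pM2l.
  + by rewrite ler_pM2l// ler_pXn2r// nnegrE// (le_trans Gy0).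
  + apply: ler_pM.
    * by rewrite !mulr_ge0// exprn_ge0.
    * by rewrite invr_ge0 exprn_ge0.
    * rewrite ler_pM2l// ler_wpM2r// ler_wpM2l ?exprn_ge0//.
      by rewrite ler_pXn2r// nnegrE; [exact: ler0n|rewrite invr_ge0 ltW].
    * by rewrite lef_pV2 ?posrE ?exprn_gt0// ler_pXn2r// nnegrE ltW.
- move=> x Xx nA; have [|i [j [k [ij jN Ji Jj]]]] := no_encounterP 'I_m J S N g g0 x Xx.
    by move=> H; apply: nA.
  by exists i, j; split; [rewrite ij jN|exact: diamJ Ji Jj].
Qed.

(** A potential whose drop from [k] to [k.+1] dominates the mass of the exceptional set at scale
    [k]: the power of the iterated logarithm of [2 ^ (k + 2)] pays for the gap terms, the geometric
    term for the mixing error. [C] is the constant in the ratio of the gap to [b] in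
    [dyadic_rare_set]. *)
Definition tail_bound (c : nat) (eta : R) (k : nat) : R :=
  let C := 20 * c%:R / ln 2 ^+ 2 in
  (4 * C + 4 * C ^+ 2) / eta * ln ((k + 2)%:R * ln 2) `^ (- eta)
  + 10 * `|K| * 2^-1 ^+ k.

Lemma tail_bound_ge0 c eta k : 0 < eta -> 0 <= tail_bound c eta k.
Proof.
move=> eta0; have C0 : 0 <= 20 * c%:R / ln 2 ^+ 2 :> R by rewrite divr_ge0// sqr_ge0.
apply: addr_ge0; last by rewrite mulr_ge0// ?exprn_ge0// mulr_ge0.
rewrite mulr_ge0 ?powR_ge0// divr_ge0 ?(ltW eta0)// addr_ge0// mulr_ge0//.
exact: sqr_ge0.
Qed.

(* At scale [2 ^ k] the blocks have length [2 ^ k] and the gap is [c (k + 3)];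
   intervals of mass less than [8 ^- k] are discarded. *)
Lemma dyadic_rare_set (rho eta : R) (c k : nat) :
  0 < rho -> 0 < eta -> (0 < c)%N -> expR (- (theta * c%:R)) <= 2^-1 ^+ 11 ->
  (c * (k + 3) <= 2 ^ k.+1)%N ->
  20 <= (k + 2)%:R * ln 2 :> R -> 1 <= ln ((k + 2)%:R * ln 2) :> R ->
  ((((k + 3)%:R * ln 2) ^+ 4 * ln ((k + 3)%:R * ln 2) `^ (2 + 2 * eta)
     / (2 ^ (k + 3))%:R ^+ 2)%:E <= \int[mu]_(y in X) mu (ball y rho))%E ->
  exists A, [/\ measurable A,
    (mu A <= (tail_bound c eta k - tail_bound c eta k.+1)%:E)%E &
    forall x, X x -> ~ A x -> exists i j : nat,
      (i < j < 2 ^ (k + 2))%N /\ `|iter i T x - iter j T x| < rho].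
Proof.
move=> rho0 eta0 c0 cexp ck a20 v1 hY.
have ln2 : 0 < ln 2 :> R by apply: ln_gt0; rewrite ltr1n.
set l := ln 2 in a20 v1 hY ln2; set a := (k + 3)%:R * l in hY.
have k3 : 0 < (k + 3)%:R :> R by rewrite ltr0n addn_gt0 orbT.
have a_prev : (k + 2)%:R * l <= a by rewrite ler_pM2r// ler_nat leq_add2l.
have prev1 : 1 < (k + 2)%:R * l by lra.
have {}a20 : 20 <= a by exact: le_trans a_prev.
have v1' : 1 <= ln a.
  apply: (le_trans v1); rewrite ler_ln ?posrE//; last by lra.
  by rewrite mulr_gt0// ltr0n addn_gt0 orbT.
set v := ln a in hY v1'; set w := v `^ (1 + eta).
have w1 : 1 <= w by apply: (le_trans v1'); apply: le1r_powR => //; lra.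
have w2 : v `^ (2 + 2 * eta) = w ^+ 2.
  by rewrite -powR_mulrn ?powR_ge0// -powRrM; congr (_ `^ _); ring.
rewrite w2 in hY.
(* Here a third of [N ^ 2 * Y] is [a ^+ 4 * w ^+ 2 / 192]; the square 400 of 20 exceeds 192 with
   room to absorb the loss from light intervals. *)
pose b := a ^+ 2 * w / 20.
have a0 : 0 <= a by lra.
have aw1 : 1 <= a * w / 20.
  by rewrite ler_pdivlMr// mul1r; apply: (le_trans a20); rewrite ler_peMr.
have b1 : 20 <= b.
  by rewrite (_ : b = a * (a * w / 20)) ?(le_trans a20) ?ler_peMr// /b; ring.
have b0 : 0 < b by lra.
pose h : R := 2^-1 ^+ k.
have h0 : 0 < h by rewrite exprn_gt0.
have h1 : h <= 1 by rewrite exprn_ile1//; lra.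
have hN : h * 2 ^+ k = 1 by rewrite /h -exprMn mulVf// expr1n.
have NE : (2 ^ k)%:R = h^-1 :> R.
  by rewrite natrX; apply: (mulfI (lt0r_neq0 h0)); rewrite hN divff// gt_eqF.
have dy : b ^+ 2 <= (2 ^ k)%:R ^+ 2 *
    ((a ^+ 4 * w ^+ 2 / (2 ^ (k + 3))%:R ^+ 2 - 4 * h ^+ 3) / 3).
  have -> : (2 ^ (k + 3))%:R = 8 * h^-1 :> R by rewrite expnD natrM NE mulrC.
  rewrite NE.
  have -> : h^-1 ^+ 2 * ((a ^+ 4 * w ^+ 2 / (8 * h^-1) ^+ 2 - 4 * h ^+ 3) / 3) =
     25 / 12 * b ^+ 2 - 4 / 3 * h by rewrite /b; field; exact: lt0r_neq0.
  have : b <= b ^+ 2 by rewrite expr2 ler_peMr//; lra.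
  lra.
have g0 : (0 < c * (k + 3))%N by rewrite muln_gt0 c0 addn_gt0 orbT.
have [A [mA muA hA]] := exists_rare_set rho (h ^+ 3) _ b (2 ^ k) (c * (k + 3))
  rho0 (exprn_gt0 3 h0) g0 b0 dy hY.
exists A; split => //; last first.
  move=> x Xx /(hA x Xx)[i [j [/andP[ij jN] d]]]; exists i, j; split => //.
  (* The two blocks take up [2 ^ k.+1] times and the gap at most as many. *)
  rewrite ij (leq_trans jN)// (_ : k + 2 = k.+2)%N ?addn2// !expnS.
  by rewrite [leqRHS]mul2n -addnn leq_add2l -expnS.
apply: (le_trans muA); rewrite lee_fin NE.
set C := 20 * c%:R / l ^+ 2.
have C0 : 0 <= C by rewrite divr_ge0// sqr_ge0.
pose z := ((k + 3)%:R * w)^-1.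
have kw1 : 1 <= (k + 3)%:R * w.
  by rewrite -[leLHS]mulr1 ler_pM// ler1n addn_gt0 orbT.
have z01 : 0 <= z <= 1.
  by rewrite invr_ge0 invf_le1// ?(le_trans ler01)// (lt_le_trans ltr01).
have gb : (c * (k + 3))%:R / b = C * z.
  rewrite natrM /b /C /z /a; field; rewrite !gt_eqF//.
  by apply: lt_le_trans w1.
have tele : eta * z <= ln ((k + 2)%:R * l) `^ (- eta) - ln ((k.+1 + 2)%:R * l) `^ (- eta).
  rewrite addSn /z /w /v /a addnS.
  by apply: inv_mul_lnX_telescope => //; rewrite addn_gt0 orbT.
(* The fourth power of the block length and the squared number of intervals amount to [h ^- 10]; the
   mixing error is at most [|K| * h ^+ 11], so one factor [h] survives and makes the series
   converge. *)
have err : 5 * (h^-1 ^+ 4 * (h ^+ 3)^-1 ^+ 2 * mix_err (c * (k + 3))) / b ^+ 4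
    <= 5 * `|K| * h.
  have me : mix_err (c * (k + 3)) <= `|K| * h ^+ 11.
    rewrite ler_wpM2l// natrM mulrA -mulNr mulrC expRM_natl.
    have e2 : expR (- (theta * c%:R)) <= 1.
      by apply: (le_trans cexp); rewrite exprn_ile1//; lra.
    rewrite exprD -exprM mulnC exprM.
    apply: (@le_trans _ _ (expR (- (theta * c%:R)) ^+ k)).
      by rewrite ler_piMr ?exprn_ge0 ?expR_ge0// exprn_ile1 ?expR_ge0.
    by apply: lerXn2r => //; rewrite nnegrE ?expR_ge0 ?exprn_ge0.
  have b4 : 1 <= b ^+ 4 by rewrite exprn_ege1//; lra.
  rewrite ler_pdivrMr; last by lra.
  apply: (@le_trans _ _ (5 * `|K| * h)); last first.
    by rewrite ler_peMr// !mulr_ge0// ltW.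
  apply: (@le_trans _ _ (5 * (h^-1 ^+ 4 * (h ^+ 3)^-1 ^+ 2 * (`|K| * h ^+ 11)))).
    by rewrite ler_pM2l// ler_wpM2l// mulr_ge0// ?sqr_ge0// exprn_ge0// invr_ge0 ltW.
  rewrite le_eqVlt; apply/orP; left; apply/eqP; field; exact: lt0r_neq0.
rewrite gb /tail_bound -/l -/C [2^-1 ^+ k.+1]exprS -/h.
have /andP[z0 z1] := z01.
have zz : (C * z) ^+ 2 <= C ^+ 2 * z.
  by rewrite exprMn ler_wpM2l ?sqr_ge0// expr2 ler_piMr.
set V0 := ln ((k + 2)%:R * l) `^ _ in tele *.
set V1 := ln ((k.+1 + 2)%:R * l) `^ _ in tele *.
have main : 4 * (C * z) + 4 * (C ^+ 2 * z) <=
    (4 * C + 4 * C ^+ 2) / eta * V0 - (4 * C + 4 * C ^+ 2) / eta * V1.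
  rewrite -mulrBr (_ : _ + _ = (4 * C + 4 * C ^+ 2) * z); last by ring.
  rewrite -mulrA ler_wpM2l//; first by rewrite addr_ge0// mulr_ge0// sqr_ge0.
  by rewrite ler_pdivlMl.
move: err zz main.
set D0 := _ / eta * V0; set D1 := _ / eta * V1; set err := _ / b ^+ 4.
set Cz2 := C ^+ 2 * z; set Cz := C * z; set s := Cz ^+ 2; set Kh := 5 * `|K| * h.
have -> : 10 * `|K| * h = 2 * Kh by rewrite /Kh; ring.
have -> : 10 * `|K| * (2^-1 * h) = Kh by rewrite /Kh; field.
by lra.
Qed.

Lemma measurable_Fset n (s : R) : measurable (Fset X T n s).
Proof.
rewrite (_ : Fset X T n s = \bigcup_i \bigcup_(j in [set j | (i < j < n)%N])
    (X `&` [set x | `|iter i T x - iter j T x| < s])); last first.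
  apply/seteqP; split => x.
    by move=> [Xx [i [j [ij d]]]]; exists i => //; exists j.
  by move=> [i _ [j ij [Xx d]]]; split => //; exists i, j.
apply: bigcup_measurable => i _; apply: bigcup_measurable => j _.
have mf : measurable_fun X (fun x => `|iter i T x - iter j T x|).
  apply: measurableT_comp => //; apply: measurable_funB; exact: measurable_iter.
exact: (mf mX `]-oo, s[%classic (measurable_itv _)).
Qed.

End Dynamics.

(** * Borel-Cantelli along the powers of two *)

Theorem mainTheorem14 (R : realType) (X : set R) (mu : probability R R)
  (T : R -> R) (r : nat -> R) :
  is_interval X -> mu X = 1%E ->
  (forall x, X x -> X (T x)) -> measurable_fun X T ->
  (forall A, measurable A -> mu (X `&` T @^-1` A) = mu A) ->
  (exists2 theta : R, 0 < theta &
     (forall psi1 psi2 phi1 phi2 : R -> R,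
        BV_on X psi1 -> BV_on X psi2 -> Linfty_on mu X phi1 -> Linfty_on mu X phi2 ->
        exists C : R, mix4_bound mu X T theta C psi1 psi2 phi1 phi2) /\
     (exists K : R, forall I1 I2 I3 I4 : set R,
        is_interval I1 -> is_interval I2 -> is_interval I3 -> is_interval I4 ->
        mix4_bound mu X T theta K (\1_I1) (\1_I2) (\1_I3) (\1_I4))) ->
  (forall n, 0 < r n) ->
  (forall n m, (n <= m)%N -> r m <= r n) ->
  (exists2 beta : R, 0 < beta & forall n, (1 <= n)%N -> n%:R `^ (- beta) <= r n) ->
  (exists2 eps : R, 0 < eps & exists N : nat, forall n, (N <= n)%N ->
     (\int[mu]_(y in X) mu (ball y (r n)) >=
      ((ln n%:R ^+ 4 * (ln (ln n%:R)) `^ (2 + eps)) / (n%:R ^+ 2))%:E)%E) ->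
  mu (liminf_set (fun n => Fset X T n (4 * r n))) = 1%E.

Proof.
move=> iX muX TX mT invT [theta theta0 [_ [K mixT]]] r0 rdec _ [eps eps0 [N0 hN0]].
have mX : measurable X by exact: is_interval_measurable.
have ln2 : 0 < ln 2 :> R by apply: ln_gt0; rewrite ltr1n.
(* The exponent [2 + eps] becomes twice the exponent [1 + eta] of the convergent series. *)
pose eta := eps / 2; have eta0 : 0 < eta by rewrite divr_gt0.
have [c c0 cexp] : exists2 c, (0 < c)%N & expR (- (theta * c%:R)) <= 2^-1 ^+ 11.
  (* By [1 + s <= expR s] at [s = theta * c], any [c] above [2 ^+ 11 / theta] is large enough. *)
  exists (Num.trunc (2 ^+ 11 / theta)).+1 => //.
  rewrite expRN exprVn lef_pV2 ?posrE ?expR_gt0 ?exprn_gt0//.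
  apply: le_trans (expR_ge1Dx _).
  have := truncnS_gt (2 ^+ 11 / theta); rewrite ltr_pdivrMr// mulrC => /ltW.
  by move=> /le_trans; apply; rewrite lerDr.
have [k1 hk1] := linear_le_exp2 c.
(* Beyond [k2], [(k + 2)%:R * ln 2] is at least 20, and at least [expR 1], so that its logarithm is
   at least 1. *)
pose k2 := Num.trunc ((20 + expR 1) / ln 2 : R).
pose k0 := (k1 + N0 + k2.+1)%N.
pose u n := tail_bound K c eta (k0 + n).
(* The times stay below [2 ^ (k + 2)] while the radius is the one at [2 ^ (k + 3)]: as [r]
   decreases, a single set serves every [n] between these two powers. *)
have step n : exists A, [/\ measurable A, (mu A <= (u n - u n.+1)%:E)%E &
    forall x, X x -> ~ A x -> exists i j : nat,
      (i < j < 2 ^ (k0 + n + 2))%N /\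
      `|iter i T x - iter j T x| < r (2 ^ (k0 + n + 3))%N].
  rewrite /u addnS; set k := (k0 + n)%N.
  have big : 20 + expR 1 <= (k + 2)%:R * ln 2 :> R.
    rewrite -ler_pdivrMr//; apply: (le_trans (ltW (truncnS_gt _))).
    by rewrite ler_nat -/k2 /k /k0; lia.
  have e0 := expR_gt0 (1 : R).
  apply: (dyadic_rare_set mu X T theta K) => //.
  - by apply: hk1; rewrite /k /k0; lia.
  - by lra.
  - by rewrite -[leLHS](expRK 1) ler_ln ?posrE//; lra.
  have kN : (N0 <= 2 ^ (k + 3))%N.
    apply: leq_trans (ltnW (ltn_expl _ (isT : (1 < 2)%N))).
    by rewrite /k /k0; lia.
  have -> : (k + 3)%:R * ln 2 = ln (2 ^ (k + 3))%:R :> R.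
    by rewrite natrX lnXn ?ltr0n// mulr_natl.
  have -> : 2 * eta = eps by rewrite /eta; field.
  exact: hN0.
have [F hF] := choice step.
have mF n : measurable (F n) by case: (hF n).
have muF : mu (lim_sup_set F) = 0%E.
  apply: (lim_sup_set_telescope _ _ _ mu F u) => // n.
    exact: tail_bound_ge0.
  by case: (hF n).
have mLs : measurable (lim_sup_set F).
  by apply: bigcap_measurable => // n _; exact: bigcup_measurable.
have mLi : measurable (liminf_set (fun n => Fset X T n (4 * r n))).
  apply: bigcup_measurable => n _; apply: bigcap_measurableType => m _.
  exact: measurable_Fset.
apply/eqP; rewrite eq_le probability_le1//=.
have <- : mu (X `\` lim_sup_set F) = 1%E.
  rewrite setDE measure_setI_full//; last exact: measurableC.
  by rewrite probability_setC// muF sube0.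
apply: le_measure; rewrite ?inE//; first exact: measurableD.
move=> x [Xx /existsNP[n0 /not_implyP[_ nx]]].
have nF n : (n0 <= n)%N -> ~ F n x by move=> n0n Fx; apply: nx; exists n.
exists (2 ^ (k0 + n0 + 2))%N => // n /= nbig.
have n_gt0 : (0 < n)%N by apply: leq_trans nbig; rewrite expn_gt0.
have /andP[lo hi] := trunc_log_bounds (isT : (1 < 2)%N) n_gt0.
have kn : (k0 + n0 + 2 <= trunc_log 2 n)%N by exact: trunc_log_max.
(* Chosen so that [2 ^ (k0 + m + 2) <= n < 2 ^ (k0 + m + 3)], the dyadic range served by [F m]. *)
pose m := (trunc_log 2 n - k0 - 2)%N.
have mE : (trunc_log 2 n = k0 + m + 2)%N by rewrite /m; lia.
have [_ _ /(_ x Xx)] := hF m.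
case; first by apply: nF; lia.
move=> i [j [/andP[ij jN] d]]; split => //; exists i, j; split.
  by rewrite ij (leq_trans jN)// -mE.
apply: (lt_le_trans d); apply: (@le_trans _ _ (r n)).
  by apply: rdec; apply: ltnW; move: hi; rewrite mE addn3 addn2.
by have := r0 n; lra.
Qed.
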